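(* Let $\alpha,\beta\in\mathcal{R}^m$ with $\overline{\alpha}\neq 0$, $\overline{\beta}\neq 0$, such that $\mathrm{spair}(\alpha,\beta)$ is regular and $\mathrm{lcm}(\mathrm{lt}(\overline{\alpha}),\mathrm{lt}(\overline{\beta}))=\mathrm{lt}(\overline{\alpha})\,\mathrm{lt}(\overline{\beta})$ (up to a nonzero constant). Then $\mathrm{spair}(\alpha,\beta)$ regular $\mathfrak{s}$-reduces to zero with respect to $\{\alpha,\beta\}$.
   Context: $\mathcal{R}$ is a polynomial ring in finitely many variables over a field $\mathcal{K}$. A monomial is a polynomial with exactly one term (coefficients allowed). $f_1,\dots,f_m\in\mathcal{R}$ are given input polynomials. $\mathcal{R}^m$ is the free module with canonical basis $\boldsymbol{e}_1,\dots,\boldsymbol{e}_m$; a module monomial is $a\boldsymbol{e}_i$ with $a$ a monomial. The homomorphism $\alpha\mapsto\overline{\alpha}$ from $\mathcal{R}^m$ to $\mathcal{R}$ is $\overline{\alpha}=\sum_i\alpha_if_i$; $\alpha$ is a syzygy if $\overline{\alpha}=0$. Fix a monomial order $\le$ on $\mathcal{R}$ and a module monomial order $\le$ on $\mathcal{R}^m$ (a well-order on module monomials such that $S\le T$ implies $cS\le cT$ for all monomials $c$) which are compatible: $a\le b$ iff $a\boldsymbol{e}_i\le b\boldsymbol{e}_i$ for all monomials $a,b$ and all $i$ (coefficients are disregarded in comparisons). $\mathrm{lt}(f)$ is the lead term (with coefficient) of $f\in\mathcal{R}\setminus\{0\}$. The signature $\mathfrak{s}(\alpha)$ of $\alpha\in\mathcal{R}^m\setminus\{0\}$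 is the $\le$-maximal term of $\alpha$. $x\simeq y$ means equality up to a nonzero constant of $\mathcal{K}$. For $\alpha,\beta\in\mathcal{R}^m$ with $\overline{\alpha},\overline{\beta}\neq0$ and $\lambda$ the monic least common multiple of $\mathrm{lt}(\overline{\alpha})$ and $\mathrm{lt}(\overline{\beta})$, the S-pair is $\mathrm{spair}(\alpha,\beta)=\frac{\lambda}{\mathrm{lt}(\overline{\alpha})}\alpha-\frac{\lambda}{\mathrm{lt}(\overline{\beta})}\beta\in\mathcal{R}^m$. It is singular if $\mathfrak{s}\big(\frac{\lambda}{\mathrm{lt}(\overline{\alpha})}\alpha\big)\simeq\mathfrak{s}\big(\frac{\lambda}{\mathrm{lt}(\overline{\beta})}\beta\big)$, otherwise regular. Let $\delta\in\mathcal{R}^m$ and let $t$ be a term of $\overline{\delta}$. One can $\mathfrak{s}$-reduce $t$ by $\epsilon\in\mathcal{R}^m$ if there is a monomial $b$ with $\mathrm{lt}(\overline{b\epsilon})=t$ and $\mathfrak{s}(b\epsilon)\le\mathfrak{s}(\delta)$; the outcome of this step is $\delta-b\epsilon$. The step is singular if $\mathfrak{s}(b\epsilon)\simeq\mathfrak{s}(\delta)$, otherwise it is regular. An element regular $\mathfrak{s}$-reduces to zero w.r.t. a finite set $B\subset\mathcal{R}^m$ if some finite sequence of regular $\mathfrak{s}$-reduction steps with reducers from $B$ transforms it into a syzygy (which need not be $0\in\mathcal{R}^m$). *)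

(* Defs.v *)
From Stdlib Require Export Relation_Operators.
From HB Require Import structures.
From mathcomp Require Export all_boot all_order all_algebra.
From mathcomp Require Export wochoice.
From mathcomp Require Export mpoly.

Set Implicit Arguments.
Unset Strict Implicit.
Unset Printing Implicit Defensive.

Import GRing.Theory.
Local Open Scope ring_scope.

(* Since comparisons disregard coefficients, an order on monomials is a        *)
(* relation on exponents 'X_{1..n}, and an order on the module monomials of    *)
(* R^m is a relation on pairs (a, i), which encode X^a e_i.  The free module   *)
(* R^m is the type of row vectors, with e_i = delta_mx 0 i.                    *)

Section Orders.
Variables n m : nat.
Implicit Types (le : rel 'X_{1..n}) (leM : rel ('X_{1..n} * 'I_m)).

Definition monomial_order le :=
  well_order le /\ forall a b c, le a b -> le (c + a)%MM (c + b)%MM.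

Definition module_monomial_order leM :=
  well_order leM /\
  forall u v c, leM u v -> leM ((c + u.1)%MM, u.2) ((c + v.1)%MM, v.2).

Definition compatible_orders le leM :=
  forall a b i, le a b = leM (a, i) (b, i).

End Orders.

Section Polynomials.
Variables (n : nat) (K : fieldType).
Implicit Types (le : rel 'X_{1..n}) (p q t : {mpoly K[n]}).

Definition is_monomial p := exists c a, c != 0 /\ p = c *: 'X_[a].

Definition term_of p t := exists2 a, a \in msupp p & t = p@_a *: 'X_[a].

Definition poly_simeq p q := exists2 c : K, c != 0 & p = c *: q.

(* The default value 0%MM is reached only for p = 0. *)
Definition lead_mon le p : 'X_{1..n} :=
  head 0%MM (sort (fun a b => le b a) (msupp p)).

Definition lead_term le p : {mpoly K[n]} :=
  p@_(lead_mon le p) *: 'X_[lead_mon le p].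

Definition lead_lcm le p q : 'X_{1..n} :=
  mlcm (lead_mon le p) (lead_mon le q).

(* For p != 0 and lead_mon le p dividing l, this is the exact quotient         *)
(* 'X_[l] / lead_term le p.                                                    *)
Definition lead_quotient le (l : 'X_{1..n}) p : {mpoly K[n]} :=
  (p@_(lead_mon le p))^-1 *: 'X_[(l - lead_mon le p)%MM].

End Polynomials.

Section Signatures.
Variables (n m : nat) (K : fieldType).
Variable f : 'I_m -> {mpoly K[n]}.
Variables (le : rel 'X_{1..n}) (leM : rel ('X_{1..n} * 'I_m)).
Implicit Types (alpha beta delta epsilon : 'rV[{mpoly K[n]}]_m).
Implicit Types (s t : 'rV[{mpoly K[n]}]_m) (B : seq 'rV[{mpoly K[n]}]_m).

Definition eval_mod alpha : {mpoly K[n]} := \sum_i alpha 0 i * f i.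

Definition syzygy alpha := eval_mod alpha = 0.

Definition mod_mon (c : K) (u : 'X_{1..n} * 'I_m) : 'rV[{mpoly K[n]}]_m :=
  (c *: 'X_[u.1]) *: delta_mx 0 u.2.

Definition mod_supp alpha : seq ('X_{1..n} * 'I_m) :=
  [seq (a, i) | i <- enum 'I_m, a <- msupp (alpha 0 i)].

(* The junk value 0 is reached only for alpha = 0. *)
Definition signature alpha : 'rV[{mpoly K[n]}]_m :=
  if sort (fun u v => leM v u) (mod_supp alpha) is u :: _
  then mod_mon (alpha 0 u.2)@_u.1 u else 0.

Definition mod_simeq s t := exists2 c : K, c != 0 & s = c%:MP *: t.

(* leM on module monomials with nonzero coefficients; false if s or t is 0. *)
Definition mod_mon_le s t := exists c d u v,
  [/\ c != 0, d != 0, s = mod_mon c u, t = mod_mon d v & leM u v].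

Definition spair_left alpha beta : 'rV[{mpoly K[n]}]_m :=
  let l := lead_lcm le (eval_mod alpha) (eval_mod beta) in
  lead_quotient le l (eval_mod alpha) *: alpha.

Definition spair_right alpha beta : 'rV[{mpoly K[n]}]_m :=
  let l := lead_lcm le (eval_mod alpha) (eval_mod beta) in
  lead_quotient le l (eval_mod beta) *: beta.

Definition spair alpha beta := spair_left alpha beta - spair_right alpha beta.

Definition spair_singular alpha beta :=
  mod_simeq (signature (spair_left alpha beta))
            (signature (spair_right alpha beta)).

Definition spair_regular alpha beta := ~ spair_singular alpha beta.

Definition can_s_reduce delta (t : {mpoly K[n]}) epsilon (b : {mpoly K[n]}) :=
  [/\ term_of (eval_mod delta) t, is_monomial b,
      lead_term le (eval_mod (b *: epsilon)) = t
    & mod_mon_le (signature (b *: epsilon)) (signature delta)].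

Definition singular_step delta epsilon (b : {mpoly K[n]}) :=
  mod_simeq (signature (b *: epsilon)) (signature delta).

Definition regular_s_reduction B delta delta' :=
  exists epsilon (t b : {mpoly K[n]}),
    [/\ epsilon \in B, can_s_reduce delta t epsilon b,
        ~ singular_step delta epsilon b & delta' = delta - b *: epsilon].

Definition regular_s_reduces_to_zero B delta :=
  exists2 delta', clos_refl_trans _ (regular_s_reduction B) delta delta'
                & syzygy delta'.

End Signatures.

(* Main.v *)
Require Import Defs.
From mathcomp Require Import all_boot all_order all_algebra.
From mathcomp Require Import wochoice mpoly.

Set Implicit Arguments.
Unset Strict Implicit.
Unset Printing Implicit Defensive.

Import GRing.Theory.
Local Open Scope ring_scope.

(** Write F, G for the evaluations of alpha and beta, and F = lt F + F',
    G = lt G + G'.  When the lead terms are coprime, the S-pair is, up to a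
    constant, [lt G * alpha - lt F * beta], and expanding F and G shows that it
    evaluates to [F' G - G' F].  This is a combination of G and F with cofactors
    F' and - G', all of whose monomials lie strictly below lt F and lt G
    respectively.  The S-pair reduces to a syzygy by removing the monomials of
    these two cofactors one at a time.

    Such a step is regular because the S-pair is: the signatures of its two
    halves are distinct module monomials, so the larger one does not cancel and
    is the signature of the S-pair.  A monomial c of F' gives a reducer
    [c * beta] with signature strictly below that of [lt F * beta], and likewise
    for G' and alpha.  Subtracting it therefore does not change the signature,
    and the same bound serves for all later steps ([cofactor_reduction]).

    A step is available because what is left, [p F + q G] with p a tail of - G'
    and q a tail of F', contains lt p * lt F or lt q * lt G as a monomial,
    whichever is larger: if the two agreed, then lt G, being coprime to lt F,
    would divide lt p, which is smaller than lt G ([coprime_products_neq]).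
    Induction on the number of monomials in p and q concludes
    ([coprime_combination_reduces]).

    Leading monomials and signatures are handled through [maximum_of] on the
    support: well-orders being total, sorting a support in decreasing order
    puts its unique maximum first ([sorted_maximum]). *)

(** * Maxima for well-orders *)

Section WellOrders.
Variables (T : eqType) (R : rel T).
Hypothesis R_wo : well_order R.

Let R_chain : wo_chain R T.
Proof. exact: withinW. Qed.

Lemma well_order_total : total R.
Proof. by move=> x y; apply: (wo_chainW R_chain). Qed.

Lemma well_order_anti : antisymmetric R.
Proof. by move=> x y; apply: (wo_chain_antisymmetric R_chain). Qed.

(** The least of the three points is [x], or else it is [y] or [z], which
    antisymmetry then identifies with [x] or [y]. *)
Lemma well_order_trans : transitive R.
Proof.
move=> y x z Rxy Ryz.
have Rr v : R v v by rewrite -[R v v]orbb well_order_total.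
have [w [[]]] := R_wo (ex_intro (fun v => v \in [:: x; y; z]) x (mem_head _ _)).
rewrite !inE => /or3P[]/eqP-> lb _; first by apply: lb; rewrite !inE eqxx !orbT.
  have Ryx: R y x by apply: lb; rewrite !inE eqxx.
  by rewrite (well_order_anti (introT andP (conj Rxy Ryx))).
have Rzy: R z y by apply: lb; rewrite !inE eqxx orbT.
by rewrite -(well_order_anti (introT andP (conj Ryz Rzy))).
Qed.

Lemma sorted_maximum (s : seq T) x0 :
  s != [::] -> maximum_of R (mem s) (head x0 (sort (fun x y => R y x) s)).
Proof.
move=> s_nz; have tot : total (fun x y => R y x).
  by move=> x y; apply: well_order_total.
have := sort_sorted tot s; have ms := mem_sort (fun x y => R y x) s.
case: (sort _ s) ms => [|z r] ms /=.
  by case: s s_nz ms => // x s _ /(_ x); rewrite mem_head.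
rewrite path_sortedE => [/andP[/allP zr _]|]; last first.
  by move=> y x w Ryx Rwy; apply: well_order_trans Rwy Ryx.
split; first by rewrite -ms mem_head.
move=> x; rewrite -ms inE => /orP[/eqP->|/zr//].
by rewrite -[R z z]orbb well_order_total.
Qed.

Lemma maximum_unique (A : {pred T}) x y :
  maximum_of R A x -> maximum_of R A y -> x = y.
Proof.
by move=> [xA x_ub] [yA y_ub]; apply: well_order_anti; rewrite x_ub ?y_ub.
Qed.

Lemma head_sort_maximum (s : seq T) x0 z :
  maximum_of R (mem s) z -> head x0 (sort (fun x y => R y x) s) = z.
Proof.
move=> z_max; apply: (maximum_unique _ z_max); apply: sorted_maximum.
by case: s z_max => // -[].
Qed.

End WellOrders.

(** * Leading monomials *)

Section LeadingMonomials.
Variables (n : nat) (K : fieldType) (le : rel 'X_{1..n}).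
Hypothesis le_order : monomial_order le.
Implicit Types (p q : {mpoly K[n]}) (a b c d : 'X_{1..n}).

Let le_anti : antisymmetric le := well_order_anti le_order.1.
Let le_trans : transitive le := well_order_trans le_order.1.

Lemma monomial_order_add2r a b c : le a b -> le (a + c)%MM (b + c)%MM.
Proof. by rewrite ![(_ + c)%MM]addmC; apply: le_order.2. Qed.

(** The least monomial [x] satisfies [x + x <= x + 0 = x <= x + x], so it is
    [0]; well-ordering thus makes the order extend divisibility. *)
Lemma dvdm_monomial_order a b : (a <= b)%MM -> le a b.
Proof.
move=> ab; suff le0 c : le 0%MM c.
  by rewrite -(submK ab) -{1}[a]add0m monomial_order_add2r.
have [x [[_ x_min] _]] :=
  le_order.1 _ (ex_intro (fun v => v \in predT) 0%MM isT).
have xx: (x + x)%MM = x.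
  by apply: le_anti; rewrite x_min // -{3}[x]addm0 le_order.2 // x_min.
suff <- : x = 0%MM by apply: x_min.
by apply/(@addmI _ x); rewrite xx addm0.
Qed.

Lemma lead_monP p : p != 0 -> maximum_of le (mem (msupp p)) (lead_mon le p).
Proof. by rewrite -msupp_eq0; apply: sorted_maximum le_order.1 _ _. Qed.

Lemma lead_mon_maximum p a :
  maximum_of le (mem (msupp p)) a -> lead_mon le p = a.
Proof. exact: head_sort_maximum le_order.1 _ _ _. Qed.

Lemma mcoeff_mulCX (k : K) a b p :
  ((k *: 'X_[a]) * p)@_(a + b) = k * p@_b.
Proof. by rewrite -scalerAl mcoeffZ mulrC [_ * p]mulrC mcoeffMX mulrC. Qed.

Lemma mem_msupp_mulCX (k : K) a p : k != 0 ->
  msupp ((k *: 'X_[a]) * p) =i [seq (a + b)%MM | b <- msupp p].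
Proof.
by move=> k_nz x; rewrite -scalerAl (perm_mem (msuppZ _ k_nz)) mulrC
  (perm_mem (msuppMX _ _)).
Qed.

Lemma maximum_mulCX (k : K) a p b : k != 0 ->
  maximum_of le (mem (msupp p)) b ->
  maximum_of le (mem (msupp ((k *: 'X_[a]) * p))) (a + b)%MM.
Proof.
move=> k_nz [pb b_ub]; split=> [|x]; rewrite mem_msupp_mulCX //.
  exact: map_f.
by case/mapP=> y py ->; apply/le_order.2/b_ub.
Qed.

Lemma lead_term_mulCX (k : K) a p b : k != 0 ->
  maximum_of le (mem (msupp p)) b ->
  lead_term le ((k *: 'X_[a]) * p) = (k * p@_b) *: 'X_[a + b].
Proof.
move=> k_nz b_max; have := lead_mon_maximum (maximum_mulCX a k_nz b_max).
by rewrite /lead_term => ->; rewrite mcoeff_mulCX.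
Qed.

(** A product has no monomial above the product of the leading monomials, so
    it cannot cancel a larger monomial. *)
Lemma notin_msupp_mul p q a b c :
  maximum_of le (mem (msupp p)) a -> maximum_of le (mem (msupp q)) b ->
  le (a + b)%MM c -> (a + b)%MM != c -> c \notin msupp (p * q).
Proof.
move=> [_ a_ub] [_ b_ub] ab_c /eqP ab_neq; apply/negP=> /msuppM_le.
case/allpairsPdep=> x [y [px qy c_xy]]; apply: ab_neq; apply: le_anti.
rewrite ab_c c_xy (le_trans (monomial_order_add2r y (a_ub x px))) //.
exact/le_order.2/b_ub.
Qed.

(** Only the two leading monomials multiply to [a + b]. *)
Lemma mcoeff_lead_mul p q a b :
  maximum_of le (mem (msupp p)) a -> maximum_of le (mem (msupp q)) b ->
  (p * q)@_(a + b) = p@_a * q@_b.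
Proof.
move=> [_ a_ub] [_ b_ub]; rewrite -[p in LHS](subrK (p@_a *: 'X_[a])).
rewrite mulrDl mcoeffD mcoeff_mulCX memN_msupp_eq0 ?add0r //.
apply/negP=> /msuppM_le/allpairsPdep[x [y [px qy ab_xy]]].
move: px; rewrite (perm_mem (msupp_rem _ _)) mem_rem_uniq ?msupp_uniq //.
case/andP=> /eqP x_neq px; apply: x_neq; apply: (@addIm _ b); apply: le_anti.
rewrite monomial_order_add2r ?a_ub //= ab_xy; exact/le_order.2/b_ub.
Qed.

(** If the two products were equal, then [b], being coprime to [a], would
    divide [c], against [c < b]. *)
Lemma coprime_products_neq a b c d :
  mlcm a b = (a + b)%MM -> le c b -> c != b -> (c + a)%MM != (d + b)%MM.
Proof.
move=> ab_coprime le_cb; apply: contraNneq => cadb; apply/eqP/le_anti.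
rewrite le_cb dvdm_monomial_order //; apply/mnm_lepP=> i.
move/mnmP/(_ i): ab_coprime; move/mnmP/(_ i): cadb; rewrite !mnmE.
case: (a i) => [|e]; first by rewrite addn0 => -> _; rewrite leq_addl.
case: (b i) => // e' _; case: (leqP e.+1 e'.+1) => _ /eqP.
  by rewrite -{1}[e'.+1]add0n eqn_add2r.
by rewrite -{1}[e.+1]addn0 eqn_add2l.
Qed.

End LeadingMonomials.

(** * Signatures *)

Section Signatures.
Variables (n m : nat) (K : fieldType) (leM : rel ('X_{1..n} * 'I_m)).
Hypothesis leM_order : module_monomial_order leM.
Implicit Types (alpha beta : 'rV[{mpoly K[n]}]_m) (u v : 'X_{1..n} * 'I_m).

Lemma mem_mod_supp alpha u :
  (u \in mod_supp alpha) = (u.1 \in msupp (alpha 0 u.2)).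
Proof.
apply/allpairsPdep/idP => [[i [a [_ ia ->]]] //|ua].
by exists u.2, u.1; rewrite mem_enum; case: u ua.
Qed.

Lemma mod_suppN alpha : mod_supp (- alpha) =i mod_supp alpha.
Proof. by move=> u; rewrite !mem_mod_supp mxE (perm_mem (msuppN _)). Qed.

(** Turns every question on signatures into one on maxima of supports, where
    coefficients do not interfere. *)
Lemma signature_maximum alpha u : maximum_of leM (mem (mod_supp alpha)) u ->
  signature leM alpha = mod_mon (alpha 0 u.2)@_u.1 u.
Proof.
move=> u_max; rewrite /signature.
have := head_sort_maximum leM_order.1 u u_max.
have: sort (fun x y => leM y x) (mod_supp alpha) != [::].
  by rewrite -size_eq0 size_sort; case: u_max; case: (mod_supp alpha).
by case: (sort _ _) => //= _ _ _ ->.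
Qed.

Lemma mod_supp_maximum alpha :
  alpha != 0 -> exists u, maximum_of leM (mem (mod_supp alpha)) u.
Proof.
move=> alpha_nz; have [i ai_nz]: exists i, alpha 0 i != 0.
  apply/existsP; apply: contra_neqT alpha_nz.
  rewrite negb_exists => /forallP a0.
  by apply/rowP=> i; rewrite mxE; apply/eqP/negPn/a0.
have: mod_supp alpha != [::].
  case def_s: (msupp (alpha 0 i)) => [|a s].
    by case/eqP: ai_nz; apply: msuppnil0.
  have: (a, i) \in mod_supp alpha by rewrite mem_mod_supp def_s mem_head.
  by case: (mod_supp alpha).
by move/(sorted_maximum leM_order.1 (0%MM, i)); exists (head (0%MM, i)
  (sort (fun x y => leM y x) (mod_supp alpha))).
Qed.

Lemma maximum_scale_mon (k : K) a alpha u : k != 0 ->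
  maximum_of leM (mem (mod_supp alpha)) u ->
  maximum_of leM (mem (mod_supp ((k *: 'X_[a]) *: alpha))) ((a + u.1)%MM, u.2).
Proof.
move=> k_nz [ua u_ub]; split=> [|[x i]]; rewrite mem_mod_supp mxE /=.
  by rewrite mem_msupp_mulCX // map_f // -mem_mod_supp.
rewrite mem_msupp_mulCX // => /mapP[y iy ->].
by apply: (leM_order.2 (y, i)); apply: u_ub; rewrite mem_mod_supp.
Qed.

Lemma maximum_addr alpha beta u :
  maximum_of leM (mem (mod_supp alpha)) u ->
  {in mod_supp beta, forall v, leM v u /\ v != u} ->
  maximum_of leM (mem (mod_supp (alpha + beta))) u.
Proof.
move=> [ua u_ub] beta_lt; split=> [|v]; rewrite mem_mod_supp mxE.
  have: u \notin mod_supp beta.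
    by apply/negP=> /beta_lt[_]; rewrite eqxx.
  rewrite mem_mod_supp => /memN_msupp_eq0 beta_u.
  by rewrite mcoeff_msupp mcoeffD beta_u addr0 -mcoeff_msupp -mem_mod_supp.
move/msuppD_le; rewrite mem_cat -!mem_mod_supp => /orP[/u_ub//|].
by case/beta_lt.
Qed.

(** Subtracting something of smaller signature leaves the signature's module
    monomial unchanged. *)
Lemma maximum_subr alpha beta u v :
  maximum_of leM (mem (mod_supp alpha)) u ->
  maximum_of leM (mem (mod_supp beta)) v -> leM v u -> v != u ->
  maximum_of leM (mem (mod_supp (alpha - beta))) u.
Proof.
move=> u_max [_ v_ub] vu v_neq; apply: maximum_addr => // w.
rewrite mod_suppN => /v_ub wv; split.
  exact: (well_order_trans leM_order.1 wv vu).
apply: contraNneq v_neq => wu; rewrite wu in wv.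
by apply/eqP/(well_order_anti leM_order.1); rewrite vu wv.
Qed.

Lemma maximum_opp alpha u : maximum_of leM (mem (mod_supp alpha)) u ->
  maximum_of leM (mem (mod_supp (- alpha))) u.
Proof.
by case=> ua u_ub; split=> [|v]; rewrite mod_suppN //; apply: u_ub.
Qed.

Lemma mod_mon_simeq (k l : K) u v :
  k != 0 -> mod_simeq (mod_mon k u) (mod_mon l v) -> u = v.
Proof.
move=> k_nz [x _ /matrixP/(_ 0 u.2)]; rewrite !mxE !eqxx mulr1.
case: (altP (u.2 =P v.2)) => [uv2|_]; last first.
  by rewrite mulrb /= !mulr0 => /(congr1 (mcoeff u.1))/eqP;
    rewrite mcoeffZ mcoeffX eqxx mcoeff0 mulr1 (negPf k_nz).
rewrite /= mulr1 => /(congr1 (mcoeff u.1))/eqP.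
rewrite mcoeffCM !mcoeffZ !mcoeffX eqxx mulr1.
case: (v.1 =P u.1) => [uv1|_]; last by rewrite mulrb /= !mulr0 (negPf k_nz).
by case: u v uv1 uv2 => [? ?] [? ?] /= -> ->.
Qed.

Lemma simeq_mod_mon (k l : K) u :
  k != 0 -> l != 0 -> mod_simeq (mod_mon k u) (mod_mon l u).
Proof.
move=> k_nz l_nz; exists (k / l); first by rewrite mulf_neq0 ?invr_neq0.
by rewrite /mod_mon scalerA mul_mpolyC scalerA divfK.
Qed.

End Signatures.

(** * Regular reduction of a combination of two elements *)

Section Reduction.
Variables (n m : nat) (K : fieldType) (f : 'I_m -> {mpoly K[n]}).
Variables (le : rel 'X_{1..n}) (leM : rel ('X_{1..n} * 'I_m)).
Hypothesis le_order : monomial_order le.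
Hypothesis leM_order : module_monomial_order leM.
Hypothesis le_compat : compatible_orders le leM.
Implicit Types (alpha beta delta epsilon : 'rV[{mpoly K[n]}]_m).
Implicit Types (p q h : {mpoly K[n]}) (B : seq 'rV[{mpoly K[n]}]_m).

Lemma eval_modZ p alpha : eval_mod f (p *: alpha) = p * eval_mod f alpha.
Proof.
by rewrite /eval_mod mulr_sumr; apply: eq_bigr => i _; rewrite mxE mulrA.
Qed.

Lemma eval_modB alpha beta :
  eval_mod f (alpha - beta) = eval_mod f alpha - eval_mod f beta.
Proof.
by rewrite /eval_mod -sumrB; apply: eq_bigr => i _; rewrite !mxE mulrBl.
Qed.

(** The monomial [d] bounds the cofactor [p] strictly, so every multiple of
    [epsilon] by a monomial of [p] has signature strictly below the one of
    [X^d epsilon], hence below [u]: this is what makes the step regular and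
    keeps [u] as the signature for the next step. *)
Lemma cofactor_reduction B delta epsilon p h a c d s u :
  epsilon \in B ->
  maximum_of le (mem (msupp (eval_mod f epsilon))) a ->
  maximum_of leM (mem (mod_supp epsilon)) s ->
  maximum_of leM (mem (mod_supp delta)) u ->
  maximum_of le (mem (msupp p)) c -> le c d -> c != d ->
  leM ((d + s.1)%MM, s.2) u ->
  eval_mod f delta = p * eval_mod f epsilon + h ->
  (c + a)%MM \notin msupp h ->
  let b := p@_c *: 'X_[c] in
  [/\ regular_s_reduction f le leM B delta (delta - b *: epsilon),
      maximum_of leM (mem (mod_supp (delta - b *: epsilon))) u
    & eval_mod f (delta - b *: epsilon) = (p - b) * eval_mod f epsilon + h].
Proof.
move=> epsB a_max s_max u_max c_max le_cd c_neq ds_u ev_delta ca_h b.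
have pc_nz: p@_c != 0 by rewrite -mcoeff_msupp; case: c_max.
have ea_nz: (eval_mod f epsilon)@_a != 0 by rewrite -mcoeff_msupp; case: a_max.
have bs_max := maximum_scale_mon leM_order c pc_nz s_max.
have cs_ds: leM ((c + s.1)%MM, s.2) ((d + s.1)%MM, s.2).
  by rewrite -le_compat; apply: monomial_order_add2r le_cd.
have cs_u := well_order_trans leM_order.1 cs_ds ds_u.
have cs_neq: ((c + s.1)%MM, s.2) != u.
  apply: contraNneq c_neq => cs_eq.
  have /(congr1 fst) cd: ((c + s.1)%MM, s.2) = ((d + s.1)%MM, s.2).
    by apply: (well_order_anti leM_order.1); rewrite cs_ds cs_eq ds_u.
  by apply/eqP; apply: addIm cd.
have lt_b: lead_term le (eval_mod f (b *: epsilon)) =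
    (p@_c * (eval_mod f epsilon)@_a) *: 'X_[c + a].
  by rewrite eval_modZ; apply: lead_term_mulCX.
split; last by rewrite eval_modB eval_modZ ev_delta mulrBl addrAC.
  exists epsilon, (lead_term le (eval_mod f (b *: epsilon))), b.
  have sig_b := signature_maximum leM_order bs_max.
  have sig_delta := signature_maximum leM_order u_max.
  have cb_nz: ((b *: epsilon) 0 s.2)@_(c + s.1) != 0.
    by rewrite -mcoeff_msupp -(mem_mod_supp _ ((c + s.1)%MM, s.2));
      case: bs_max.
  split=> //; last first.
    rewrite /singular_step sig_b sig_delta.
    by move/(mod_mon_simeq cb_nz)/eqP; rewrite (negPf cs_neq).
  split=> //.
  - have ca_coef: (eval_mod f delta)@_(c + a) =
        p@_c * (eval_mod f epsilon)@_a.
    + rewrite ev_delta mcoeffD (memN_msupp_eq0 ca_h) addr0.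
      exact: (mcoeff_lead_mul le_order).
    by exists (c + a)%MM; rewrite ?mcoeff_msupp ca_coef ?mulf_neq0 ?lt_b.
  - by exists p@_c, c.
  exists ((b *: epsilon) 0 s.2)@_(c + s.1), (delta 0 u.2)@_u.1,
    ((c + s.1)%MM, s.2), u; split=> //.
  by rewrite -mcoeff_msupp -mem_mod_supp; case: u_max.
exact: (maximum_subr leM_order u_max bs_max cs_u cs_neq).
Qed.

(** A monomial is cancelled from one of the two cofactors at each step.  By
    coprimality the two products never have the same leading monomial, so the
    larger one is a monomial of the evaluation and can be reduced, by the
    element whose cofactor it comes from.  The bounds of the monomials of [p] by
    [b] and of [q] by [a] cross over: they make [b + s.1] and [a + t.1], which
    lie below [u], bound the signatures of all reducers. *)
Lemma coprime_combination_reduces B alpha beta a b s t u :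
  alpha \in B -> beta \in B ->
  maximum_of le (mem (msupp (eval_mod f alpha))) a ->
  maximum_of le (mem (msupp (eval_mod f beta))) b ->
  mlcm a b = (a + b)%MM ->
  maximum_of leM (mem (mod_supp alpha)) s ->
  maximum_of leM (mem (mod_supp beta)) t ->
  leM ((b + s.1)%MM, s.2) u -> leM ((a + t.1)%MM, t.2) u ->
  forall p q delta,
  {in msupp p, forall x, le x b /\ x != b} ->
  {in msupp q, forall x, le x a /\ x != a} ->
  maximum_of leM (mem (mod_supp delta)) u ->
  eval_mod f delta = p * eval_mod f alpha + q * eval_mod f beta ->
  regular_s_reduces_to_zero f le leM B delta.
Proof.
move=> alphaB betaB a_max b_max ab_coprime s_max t_max bs_u at_u p q.
have [N] := ubnP (size (msupp p) + size (msupp q)).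
elim: N p q => // N IH p q size_pq delta p_lt q_lt u_max ev_delta.
have in_tail (r : {mpoly K[n]}) c x :
    x \in msupp (r - r@_c *: 'X_[c]) -> x \in msupp r.
  by rewrite (perm_mem (msupp_rem _ _)) => /mem_rem.
have size_tail (r : {mpoly K[n]}) c : c \in msupp r ->
    size (msupp r) = (size (msupp (r - r@_c *: 'X_[c]))).+1.
  move=> rc; rewrite (perm_size (msupp_rem _ _)) size_rem // prednK //.
  by case: (msupp r) rc.
have reduce_alpha c : maximum_of le (mem (msupp p)) c ->
    (c + a)%MM \notin msupp (q * eval_mod f beta) ->
    regular_s_reduces_to_zero f le leM B delta.
  move=> c_max ca_q; have pc: c \in msupp p by case: c_max.
  have [le_cb c_neq] := p_lt c pc.
  have [red u_max' ev'] := cofactor_reduction alphaB a_max s_max u_max c_max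
    le_cb c_neq bs_u ev_delta ca_q.
  have [||delta' red' delta'0] := IH _ _ _ _ _ q_lt u_max' ev'.
  - by rewrite -ltnS -addSn -size_tail.
  - by move=> x /in_tail/p_lt.
  by exists delta' => //; apply: rt_trans red'; apply: rt_step.
have reduce_beta d : maximum_of le (mem (msupp q)) d ->
    (d + b)%MM \notin msupp (p * eval_mod f alpha) ->
    regular_s_reduces_to_zero f le leM B delta.
  move=> d_max db_p; have qd: d \in msupp q by case: d_max.
  have [le_da d_neq] := q_lt d qd; rewrite [RHS]addrC in ev_delta.
  have [red u_max' ev'] := cofactor_reduction betaB b_max t_max u_max d_max
    le_da d_neq at_u ev_delta db_p.
  rewrite [RHS]addrC in ev'.
  have [||delta' red' delta'0] := IH _ _ _ _ p_lt _ u_max' ev'.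
  - by rewrite -ltnS -addnS -size_tail.
  - by move=> x /in_tail/q_lt.
  by exists delta' => //; apply: rt_trans red'; apply: rt_step.
have [p0|p_nz] := eqVneq p 0.
  have [q0|q_nz] := eqVneq q 0.
    exists delta; first exact: rt_refl.
    by rewrite /syzygy ev_delta p0 q0 !mul0r addr0.
  apply: reduce_beta (lead_monP le_order q_nz) _.
  by rewrite p0 mul0r msupp0.
have c_max := lead_monP le_order p_nz; set c := lead_mon le p in c_max.
have [q0|q_nz] := eqVneq q 0.
  by apply: reduce_alpha c_max _; rewrite q0 mul0r msupp0.
have d_max := lead_monP le_order q_nz; set d := lead_mon le q in d_max.
have [le_cb c_neq] := p_lt c c_max.1.
have ca_db := coprime_products_neq le_order d ab_coprime le_cb c_neq.
have [le_cd|le_dc] := orP (well_order_total le_order.1 (c + a)%MM (d + b)%MM).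
  exact: (reduce_beta d d_max
    (notin_msupp_mul le_order c_max a_max le_cd ca_db)).
rewrite eq_sym in ca_db.
exact: (reduce_alpha c c_max
  (notin_msupp_mul le_order d_max b_max le_dc ca_db)).
Qed.

End Reduction.

Theorem corollary6p1 (n m : nat) (K : fieldType) (f : 'I_m -> {mpoly K[n]})
    (le : rel 'X_{1..n}) (leM : rel ('X_{1..n} * 'I_m))
    (le_order : monomial_order le)
    (leM_order : module_monomial_order leM)
    (le_compat : compatible_orders le leM)
    (alpha beta : 'rV[{mpoly K[n]}]_m)
    (alpha_nz : eval_mod f alpha <> 0)
    (beta_nz : eval_mod f beta <> 0)
    (pair_regular : spair_regular f le leM alpha beta)
    (lead_coprime :
      poly_simeq 'X_[lead_lcm le (eval_mod f alpha) (eval_mod f beta)]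
        (lead_term le (eval_mod f alpha) * lead_term le (eval_mod f beta))) :
  regular_s_reduces_to_zero f le leM [:: alpha; beta] (spair f le alpha beta).
Proof.
have nonzero gamma : eval_mod f gamma <> 0 -> gamma != 0.
  move=> /eqP; apply: contraNneq => ->.
  by rewrite /eval_mod big1 // => i _; rewrite mxE mul0r.
have a_max := lead_monP le_order (introN eqP alpha_nz).
have b_max := lead_monP le_order (introN eqP beta_nz).
have [s s_max] := mod_supp_maximum leM_order (nonzero _ alpha_nz).
have [t t_max] := mod_supp_maximum leM_order (nonzero _ beta_nz).
move: pair_regular lead_coprime.
rewrite /spair_regular /spair_singular /spair /spair_left /spair_right.
rewrite /lead_quotient /lead_term /lead_lcm.
move: (lead_mon le (eval_mod f alpha)) (lead_mon le (eval_mod f beta))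
  a_max b_max => a b a_max b_max.
set F := eval_mod f alpha in a_max *; set G := eval_mod f beta in b_max *.
have Fa_nz: F@_a != 0 by rewrite -mcoeff_msupp; case: a_max.
have Gb_nz: G@_b != 0 by rewrite -mcoeff_msupp; case: b_max.
move=> regular [k k_nz lcm_eq].
have ab_coprime: mlcm a b = (a + b)%MM.
  move/(congr1 (mcoeff (mlcm a b))): lcm_eq.
  rewrite -scalerAl -scalerAr -mpolyXD !mcoeffZ !mcoeffX eqxx.
  by case: eqP => // _ /eqP; rewrite !mulr0 oner_eq0.
move: regular; rewrite ab_coprime {1 3}[(a + b)%MM]addmC !addmK.
set L := _ *: alpha; set R := _ *: beta => regular.
have L_max := maximum_scale_mon leM_order b (invr_neq0 Fa_nz) s_max.
have R_max := maximum_scale_mon leM_order a (invr_neq0 Gb_nz) t_max.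
rewrite -/L -/R in L_max R_max.
have sig_neq: ((b + s.1)%MM, s.2) != ((a + t.1)%MM, t.2).
  apply/eqP=> sig_eq; apply: regular.
  rewrite (signature_maximum leM_order L_max).
  rewrite (signature_maximum leM_order R_max) -sig_eq.
  by apply: simeq_mod_mon; rewrite -mcoeff_msupp;
    [case: L_max | rewrite sig_eq; case: R_max] => + _; rewrite mem_mod_supp.
have [u [u_max bs_u at_u]]: exists u,
  [/\ maximum_of leM (mem (mod_supp (L - R))) u,
      leM ((b + s.1)%MM, s.2) u & leM ((a + t.1)%MM, t.2) u].
  have [LR|RL] := orP (well_order_total leM_order.1
      ((b + s.1)%MM, s.2) ((a + t.1)%MM, t.2)).
    exists ((a + t.1)%MM, t.2); split; [|exact: LR|exact: R_max.2 R_max.1].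
    rewrite -opprB; apply: maximum_opp.
    exact: (maximum_subr leM_order R_max L_max LR sig_neq).
  exists ((b + s.1)%MM, s.2); split; [|exact: L_max.2 L_max.1|exact: RL].
  by apply: (maximum_subr leM_order L_max R_max RL); rewrite eq_sym.
have tail_lt (l : K) r c : maximum_of le (mem (msupp r)) c ->
    {in msupp (l *: (r - r@_c *: 'X_[c])), forall x, le x c /\ x != c}.
  move=> [_ c_ub] x /msuppZ_le; rewrite (perm_mem (msupp_rem _ _)).
  by rewrite mem_rem_uniq ?msupp_uniq // => /andP[x_neq /c_ub].
(* Replacing each lead term in the S-pair by the polynomial minus its tail
   leaves only the tails, scaled by the inverse of both lead coefficients. *)
pose k' := (F@_a)^-1 * (G@_b)^-1.
apply: (coprime_combination_reduces le_order leM_order le_compat _ _ a_max b_max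
  ab_coprime s_max t_max bs_u at_u (p := - k' *: (G - G@_b *: 'X_[b]))
  (q := k' *: (F - F@_a *: 'X_[a])) _ _ u_max); rewrite ?inE ?eqxx ?orbT //.
- exact: tail_lt.
- exact: tail_lt.
rewrite eval_modB !eval_modZ -/F -/G -!scalerAl !mulrBl -!scalerAl.
rewrite scaleNr !scalerBr !scalerA opprB.
have -> : k' * G@_b = (F@_a)^-1 by rewrite divfK.
have -> : k' * F@_a = (G@_b)^-1 by rewrite mulrAC mulVf ?mul1r.
by rewrite [G * F]mulrC addrA subrK.
Qed.
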